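(* If $(M,\phi,\xi,\eta,g)$ is a trans-Sasakian manifold, then $h=0$, where $2h=L_\xi\phi$.
   Context: All functions and tensors are smooth. An almost contact metric manifold $(M,\phi,\xi,\eta,g)$ is an odd-dimensional Riemannian manifold $(M,g)$ with a $(1,1)$-tensor field $\phi$, a vector field $\xi$ and a 1-form $\eta$ with $\eta(\xi)=1$, $\phi^2X=-X+\eta(X)\xi$, $g(\phi X,\phi Y)=g(X,Y)-\eta(X)\eta(Y)$. It is trans-Sasakian if there are functions $\alpha,\beta$ on $M$ such that, for all vector fields $X,Y$, $(\nabla_X\phi)Y=\alpha(g(X,Y)\xi-\eta(Y)X)+\beta(g(\phi X,Y)\xi-\eta(Y)\phi X)$, where $\nabla$ is the Levi-Civita connection. $L$ denotes the Lie derivative. *)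

(* Defs.v *)
From HB Require Import structures.
From mathcomp Require Import all_boot all_order all_algebra ring.
From mathcomp Require Import all_classical all_reals all_analysis.
Import numFieldNormedType.Exports.
Import Order.TTheory GRing.Theory Num.Theory.

Set Implicit Arguments.
Unset Strict Implicit.
Unset Printing Implicit Defensive.

Local Open Scope classical_set_scope.
Local Open Scope ring_scope.

Section Ck.
Context {R : realType} {V : normedModType R}.

Fixpoint Ck {W : normedModType R} (k : nat) (U : set V) (f : V -> W) : Prop :=
  (forall x, U x -> {for x, continuous f}) /\
  if k is k'.+1 then
    (forall x v, U x -> derivable f x v) /\ (forall v, Ck k' U ('D_v f))
  else True.

(** Only meant for [U] open, where continuity of all iterated directional
    derivatives is C^infinity smoothness. *)
Definition smooth_on {W : normedModType R} (U : set V) (f : V -> W) : Prop :=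
  forall k, Ck k U f.

Lemma Ck_cont {W : normedModType R} k (U : set V) (f : V -> W) :
  Ck k U f -> forall x, U x -> {for x, continuous f}.
Proof. by case: k => [|k] []. Qed.

Lemma CkS {W : normedModType R} k (U : set V) (f : V -> W) :
  Ck k.+1 U f -> Ck k U f.
Proof.
elim: k f => [|k IH] f [cf [df Df]]; first by split.
by split => //; split => // v; apply: IH.
Qed.

Lemma Ck_ext {W : normedModType R} k (U : set V) (f g : V -> W) :
  open U -> (forall x, U x -> f x = g x) -> Ck k U f -> Ck k U g.
Proof.
move=> oU; elim: k f g => [|k IH] f g fg Cf.
all: have nfg x (Ux : U x) : \forall y \near x, f y = g y
  by apply: filterS (open_nbhs_nbhs (conj oU Ux)) => y /fg.
all: have cg x (Ux : U x) : {for x, continuous g}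
  by rewrite /prop_for /continuous_at -(fg _ Ux);
    apply: cvg_trans (Ck_cont Cf Ux); apply: near_eq_cvg; apply: nfg.
  by split.
case: Cf => cf [df Df]; split => //; split.
  by move=> x v Ux; apply: near_eq_derivable (df _ _ Ux); apply: nfg.
by move=> v; apply: IH (Df v) => x Ux; apply: near_eq_derive; apply: nfg.
Qed.

Lemma Ck_cst {W : normedModType R} k (U : set V) (c : W) : Ck k U (cst c).
Proof.
elim: k c => [|k IH] c; (split; first by move=> x _; exact: cvg_cst) => //.
split => // v.
by rewrite (_ : 'D_v _ = cst 0) //; apply/funext => x; rewrite derive_cst.
Qed.

Lemma CkB {W : normedModType R} k (U : set V) (f g : V -> W) : open U ->
  Ck k U f -> Ck k U g -> Ck k U (f - g).
Proof.
move=> oU; elim: k f g => [|k IH] f g Cf Cg.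
  by split=> // x Ux; apply: cvgB; [apply: (Ck_cont Cf)|apply: (Ck_cont Cg)].
split; first by move=> x Ux; apply: cvgB; [apply: (Ck_cont Cf)|apply: (Ck_cont Cg)].
case: Cf Cg => _ [df Df] [_ [dg Dg]]; split=> [x v Ux|v].
  by apply: derivableB; [apply: df|apply: dg].
apply: Ck_ext (IH _ _ (Df v) (Dg v)) => // x Ux.
by rewrite deriveB; [|apply: df|apply: dg].
Qed.

Lemma CkD {W : normedModType R} k (U : set V) (f g : V -> W) : open U ->
  Ck k U f -> Ck k U g -> Ck k U (f + g).
Proof.
move=> oU Cf Cg; rewrite (_ : f + g = f - (cst 0 - g)); last first.
  by apply/funext => x; rewrite !fctE /= sub0r opprK.
by apply: CkB => //; apply: CkB => //; apply: Ck_cst.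
Qed.

Lemma CkM k (U : set V) (f g : V -> R) : open U ->
  Ck k U f -> Ck k U g -> Ck k U (f * g).
Proof.
move=> oU; elim: k f g => [|k IH] f g Cf Cg.
  by split=> // x Ux; apply: cvgM; [apply: (Ck_cont Cf)|apply: (Ck_cont Cg)].
split; first by move=> x Ux; apply: cvgM; [apply: (Ck_cont Cf)|apply: (Ck_cont Cg)].
have [Cf' Cg'] := (CkS Cf, CkS Cg).
case: Cf Cg => _ [df Df] [_ [dg Dg]]; split=> [x v Ux|v].
  by apply: derivableM; [apply: df|apply: dg].
apply: Ck_ext (CkD oU (IH _ _ Cf' (Dg v)) (IH _ _ Cg' (Df v))) => // x Ux.
by rewrite deriveM; [|apply: df|apply: dg].
Qed.

End Ck.

Record chart (R : realType) (n : nat) (T : topologicalType) := Chart {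
  chart_dom : set T ;
  chart_map : T -> 'rV[R]_n ;
  chart_inv : 'rV[R]_n -> T ;
  chart_dom_open : open chart_dom ;
  chart_img_open : open (chart_map @` chart_dom) ;
  chart_mapK : forall p, chart_dom p -> chart_inv (chart_map p) = p ;
  chart_map_cont : forall p, chart_dom p -> {for p, continuous chart_map} ;
  chart_inv_cont : forall x, (chart_map @` chart_dom) x ->
    {for x, continuous chart_inv} }.

Record manifold (R : realType) (n : nat) := Manifold {
  mcarrier :> topologicalType ;
  atlas : set (chart R n mcarrier) ;
  manifold_hausdorff : hausdorff_space mcarrier ;
  manifold_second_countable : @second_countable mcarrier ;
  atlas_cover : forall p, exists2 c, atlas c & chart_dom c p ;
  atlas_compatible : forall c c', atlas c -> atlas c' ->
    smooth_on (chart_map c @` (chart_dom c `&` chart_dom c'))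
              (chart_map c' \o chart_inv c) }.

Section SmoothFunctions.
Context {R : realType} {n : nat} (M : manifold R n).

Definition is_smooth (f : M -> R) : Prop := forall c, atlas c ->
  smooth_on (chart_map c @` chart_dom c) (f \o chart_inv c).

Definition smooth_pred : {pred M -> R} := [pred f | `[< is_smooth f >]].

Record smooth := Smooth { smooth_fun :> M -> R ; _ : smooth_fun \in smooth_pred }.

HB.instance Definition _ := [isSub for smooth_fun].
HB.instance Definition _ := [Choice of smooth by <:].

Lemma is_smooth_cst (r : R) : is_smooth (cst r).
Proof. by move=> c _ k; exact: Ck_cst. Qed.

Lemma smooth_subring_closed : subring_closed smooth_pred.
Proof.
split=> [|f g|f g]; rewrite !inE.
- exact: (is_smooth_cst 1).
- move=> sf sg c cA k.
  exact: (CkB (@chart_img_open _ _ _ c) (sf c cA k) (sg c cA k)).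
- move=> sf sg c cA k.
  exact: (CkM (@chart_img_open _ _ _ c) (sf c cA k) (sg c cA k)).
Qed.

HB.instance Definition _ :=
  GRing.SubChoice_isSubComPzRing.Build (M -> R) smooth_pred smooth
    smooth_subring_closed.

Definition smooth_cst (r : R) : smooth :=
  Smooth (introT (asboolP _) (is_smooth_cst r)).

End SmoothFunctions.

(** Vector fields are the derivations of the real algebra of smooth functions;
    below, tensor fields are the maps of vector fields that are multilinear over
    the ring of smooth functions. This ring is only a [comPzRingType], since the
    empty manifold is not excluded. *)
Section VectorFields.
Context {R : realType} {n : nat} (M : manifold R n).
Local Notation C := (smooth M).

Definition is_derivation (X : C -> C) : Prop :=
  [/\ forall f g, X (f + g) = X f + X g,
      forall r f, X (smooth_cst M r * f) = smooth_cst M r * X f &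
      forall f g, X (f * g) = X f * g + f * X g].

Definition derivation_pred : {pred C -> C} := [pred X | `[< is_derivation X >]].

Record vfield := VField {
  vfield_fun :> C -> C ; _ : vfield_fun \in derivation_pred }.

HB.instance Definition _ := [isSub for vfield_fun].
HB.instance Definition _ := [Choice of vfield by <:].

Lemma vfieldP (X : vfield) : is_derivation X.
Proof. by case: X => X /= /asboolP. Qed.

Lemma vfield_zmod_closed : zmod_closed derivation_pred.
Proof.
split=> [|X Y]; rewrite !inE.
  by split=> *;
    rewrite ![(0 : C -> C) _]/(0 : C) ?(addr0, mulr0, mul0r).
move=> [XD XZ XM] [YD YZ YM].
have sE f : (X - Y) f = X f - Y f by [].
split=> *; rewrite !sE.
- by rewrite XD YD opprD addrACA.
- by rewrite XZ YZ mulrBr.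
- by rewrite XM YM mulrBl mulrBr opprD addrACA.
Qed.

HB.instance Definition _ :=
  GRing.SubChoice_isSubZmodule.Build (C -> C) derivation_pred vfield
    vfield_zmod_closed.

Lemma vfield_scale_subproof (f : C) (X : vfield) :
  (fun g => f * X g) \in derivation_pred.
Proof.
rewrite inE; case: (vfieldP X) => XD XZ XM; split=> *.
- by rewrite XD mulrDr.
- by rewrite XZ mulrCA.
- by rewrite XM mulrDr mulrA [RHS]addrC mulrCA addrC.
Qed.

Definition vfield_scale (f : C) (X : vfield) : vfield :=
  VField (vfield_scale_subproof f X).

Lemma vfield_ext (X Y : vfield) : (forall f, X f = Y f) -> X = Y.
Proof. by move=> XY; apply/val_inj/funext. Qed.

Lemma vfieldD (X Y : vfield) f : (X + Y) f = X f + Y f.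
Proof. by []. Qed.

Lemma vfieldB (X Y : vfield) f : (X - Y) f = X f - Y f.
Proof. by []. Qed.

Fact vfield_scaleA a b X :
  vfield_scale a (vfield_scale b X) = vfield_scale (a * b) X.
Proof. by apply: vfield_ext => f /=; rewrite mulrA. Qed.

Fact vfield_scale1 : left_id 1 vfield_scale.
Proof. by move=> X; apply: vfield_ext => f /=; rewrite mul1r. Qed.

Fact vfield_scaleDr : right_distributive vfield_scale +%R.
Proof.
by move=> a X Y; apply: vfield_ext => f; exact: mulrDr.
Qed.

Fact vfield_scaleDl X : {morph vfield_scale^~ X : a b / a + b}.
Proof.
by move=> a b; apply: vfield_ext => f; exact: mulrDl.
Qed.

HB.instance Definition _ := GRing.Zmodule_isLmodule.Build C vfield
  vfield_scaleA vfield_scale1 vfield_scaleDr vfield_scaleDl.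

Lemma vfieldZ (a : C) (X : vfield) f : (a *: X) f = a * X f.
Proof. by []. Qed.

(** The tangent vector of [X] at [p]. *)
Definition vfield_at (X : vfield) (p : M) : C -> R := fun f => X f p.

Lemma bracket_subproof (X Y : vfield) :
  (fun f => X (Y f) - Y (X f)) \in derivation_pred.
Proof.
rewrite inE; case: (vfieldP X) (vfieldP Y) => XD XZ XM [YD YZ YM].
split=> *.
- by rewrite !(XD, YD) opprD addrACA.
- by rewrite !(XZ, YZ) mulrBr.
- rewrite XM YM !(XD, YD) !(XM, YM) mulrBl mulrBr.
  set a := X (Y _) * _; set b := Y _ * X _; set c := X _ * Y _.
  set d := _ * X (Y _); set e := Y (X _) * _; set k := _ * Y (X _).
  by rewrite opprD [- (e + c)]opprD [- (b + k)]opprD; ring.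
Qed.

Definition bracket (X Y : vfield) : vfield := VField (bracket_subproof X Y).

End VectorFields.

Notation "[[ X , Y ]]" := (bracket X Y) (at level 0) : ring_scope.

Section Tensors.
Context {R : realType} {n : nat} (M : manifold R n).
Local Notation C := (smooth M).
Local Notation VF := (vfield M).

Record riemannian_metric := RiemannianMetric {
  metric :> VF -> VF -> C ;
  metric_linear : forall Z, scalar (metric^~ Z) ;
  metricC : forall X Y, metric X Y = metric Y X ;
  metric_posdef : forall X p, vfield_at X p <> 0 -> 0 < metric X X p }.

Record connection := Connection {
  nabla :> VF -> VF -> VF ;
  nabla_linear : forall Y, linear (nabla^~ Y) ;
  nablaD : forall X Y Z, nabla X (Y + Z) = nabla X Y + nabla X Z ;
  nabla_leibniz : forall X (f : C) Y,
    nabla X (f *: Y) = X f *: Y + f *: nabla X Y }.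

Definition levi_civita (g : riemannian_metric) (D : connection) : Prop :=
  (forall X Y : VF, D X Y - D Y X = [[X, Y]]) /\
  (forall X Y Z : VF, X (g Y Z) = g (D X Y) Z + g Y (D X Z)).

(** [nabla_tensor D X phi Y] is [(D_X phi) Y], and [lie_tensor V phi X] is
    [(L_V phi) X], by the Leibniz rule for tensor derivations. *)
Definition nabla_tensor (D : connection) (X : VF) (phi : {linear VF -> VF})
  (Y : VF) : VF := D X (phi Y) - phi (D X Y).

Definition lie_tensor (V : VF) (phi : {linear VF -> VF}) (X : VF) : VF :=
  [[V, phi X]] - phi [[V, X]].

Lemma bracketD (V X Y : VF) : [[V, X + Y]] = [[V, X]] + [[V, Y]].
Proof.
apply: vfield_ext => f.
rewrite -[LHS]/(V (X f + Y f) - (X (V f) + Y (V f))).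
by case: (vfieldP V) => -> _ _; rewrite opprD addrACA.
Qed.

Lemma bracketZ (V X : VF) (a : C) : [[V, a *: X]] = a *: [[V, X]] + V a *: X.
Proof.
apply: vfield_ext => f.
rewrite -[LHS]/(V (a * X f) - a * X (V f)).
rewrite -[RHS]/(a * (V (X f) - X (V f)) + V a * X f).
by case: (vfieldP V) => _ _ ->; rewrite mulrBr -addrA addrC.
Qed.

Fact lie_tensor_is_linear (V : VF) (phi : {linear VF -> VF}) :
  linear (lie_tensor V phi).
Proof.
move=> a X Y; rewrite /lie_tensor !(linearD, bracketD, linearZ, bracketZ) /=.
rewrite [a *: _ + V a *: phi X + _]addrAC [a *: - _ + V a *: - _ - _]addrAC addrACA.
by rewrite [V a *: - _]scalerN subrr addr0 addrACA.
Qed.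

HB.instance Definition _ (V : VF) (phi : {linear VF -> VF}) :=
  GRing.isLinear.Build C VF VF *:%R (lie_tensor V phi)
    (lie_tensor_is_linear V phi).

End Tensors.

Record almost_contact_metric (R : realType) (n : nat)
    (M : manifold R n.*2.+1) := AlmostContactMetric {
  acm_phi : {linear vfield M -> vfield M} ;
  acm_xi : vfield M ;
  acm_eta : {scalar vfield M} ;
  acm_metric : riemannian_metric M ;
  acm_eta_xi : acm_eta acm_xi = 1 ;
  acm_phi2 : forall X, acm_phi (acm_phi X) = - X + acm_eta X *: acm_xi ;
  acm_metric_phi : forall X Y,
    acm_metric (acm_phi X) (acm_phi Y) =
    acm_metric X Y - acm_eta X * acm_eta Y }.

Definition trans_sasakian (R : realType) (n : nat) (M : manifold R n.*2.+1)
    (S : almost_contact_metric M) (D : connection M) : Prop :=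
  let phi := acm_phi S in let xi := acm_xi S in
  let eta := acm_eta S in let g := acm_metric S in
  exists alpha beta : smooth M, forall X Y : vfield M,
    nabla_tensor D X phi Y =
      alpha *: (g X Y *: xi - eta Y *: X) +
      beta *: (g (phi X) Y *: xi - eta Y *: phi X).

(* Main.v *)
Require Import Defs.
From mathcomp Require Import all_boot all_order all_algebra.
From mathcomp Require Import all_classical all_reals all_analysis.
Import Order.TTheory GRing.Theory Num.Theory.
Local Open Scope ring_scope.

(** The derivative of [phi] along [xi] vanishes, so torsion-freeness reduces the
    claim to [D_(phi X) xi = phi (D_X xi)]. Applying the trans-Sasakian
    identity to [xi] gives [phi (D_X xi) = - alpha phi^2 X + beta phi X]; since
    [xi] has constant length, [D_X xi] is orthogonal to [xi], and applying [phi]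
    once more gives [D_X xi = - alpha phi X - beta phi^2 X]. As [phi^3 = - phi],
    both sides of the claim agree. *)

Section SmoothAlgebra.
Variables (R : realType) (n : nat) (M : manifold R n).

Lemma smooth_ext (f g : smooth M) : (forall p, f p = g p) -> f = g.
Proof. by move=> fg; apply/val_inj/funext. Qed.

(** The ring of smooth functions has zero divisors, so one argues pointwise in the field [R]. *)
Lemma smooth_sqr_eq0 (f : smooth M) : f * f = 0 -> f = 0.
Proof.
move=> ff0; apply: smooth_ext => p.
have /eqP : f p * f p = 0 by rewrite -[LHS]/((f * f) p) ff0.
by rewrite mulf_eq0 orbb => /eqP.
Qed.

Lemma smooth_mulr2n_eq0 (f : smooth M) : f + f = 0 -> f = 0.
Proof.
move=> ff0; apply: smooth_ext => p.
have /eqP : f p + f p = 0 by rewrite -[LHS]/((f + f) p) ff0.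
by rewrite -mulr2n mulrn_eq0 /= => /eqP.
Qed.

Lemma vfield_mulr2n_eq0 (X : vfield M) : X *+ 2 = 0 -> X = 0.
Proof.
move=> X2; apply: vfield_ext => f; apply: smooth_mulr2n_eq0.
by rewrite -vfieldD -mulr2n X2.
Qed.

Lemma vfield_one (X : vfield M) : X 1 = 0.
Proof.
have [_ _ /(_ 1 1)] := vfieldP X; rewrite !mul1r mulr1 => X1.
by apply: (addrI (X 1)); rewrite addr0 -X1.
Qed.

Lemma nabla_zero (D : connection M) X : D X 0 = 0.
Proof. by apply: (addrI (D X 0)); rewrite -nablaD !addr0. Qed.

End SmoothAlgebra.

Section AlmostContactMetric.
Variables (R : realType) (n : nat) (M : manifold R n.*2.+1).
Variable S : almost_contact_metric M.
Notation phi := (acm_phi S).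
Notation xi := (acm_xi S).
Notation eta := (acm_eta S).
Notation g := (acm_metric S).

Lemma acm_etaZ_xi a : eta (a *: xi) = a.
Proof. by rewrite linearZ /= acm_eta_xi mulr1. Qed.

(** [phi^3 xi = 0] makes [phi xi] a multiple [f xi] of [xi], and then
    [0 = phi^2 xi = f^2 xi] forces [f = 0]. *)
Lemma acm_phi_xi : phi xi = 0.
Proof.
have p2 : phi (phi xi) = 0 by rewrite acm_phi2 acm_eta_xi scale1r addNr.
have pE : phi xi = eta (phi xi) *: xi.
  have := acm_phi2 S (phi xi); rewrite p2 linear0 => /esym/eqP.
  by rewrite addrC subr_eq0 => /eqP.
suff f0 : eta (phi xi) = 0 by rewrite pE f0 scale0r.
apply: smooth_sqr_eq0; rewrite -[RHS](linear0 eta) -p2 [in RHS]pE linearZ /=.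
by rewrite linearZ.
Qed.

Lemma acm_phi3 X : phi (phi (phi X)) = - phi X.
Proof.
rewrite [phi (phi X)]acm_phi2 linearD linearN linearZ /=.
by rewrite acm_phi_xi scaler0 addr0.
Qed.

(** Computing [phi^3 X] as [phi^2] of [phi X] gives the extra term [eta (phi X) *: xi], which must
    vanish. *)
Lemma acm_eta_phi X : eta (phi X) = 0.
Proof.
have := acm_phi2 S (phi X); rewrite acm_phi3 -{1}[- phi X]addr0.
by move=> /addrI /(congr1 eta); rewrite linear0 acm_etaZ_xi.
Qed.

Lemma acm_metric0r X : g X 0 = 0.
Proof.
(* The scalar [-1] makes the right side of linearity cancel. *)
rewrite metricC; have := metric_linear g X (-1) 0 0.
by rewrite scaler0 addr0 mulN1r addNr.
Qed.

Lemma acm_metric_xi X : g X xi = eta X.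
Proof.
have := acm_metric_phi S X xi.
rewrite acm_phi_xi acm_metric0r acm_eta_xi mulr1 => /esym/eqP.
by rewrite subr_eq0 => /eqP.
Qed.

Section LeviCivita.
Variable D : connection M.
Hypothesis hD : levi_civita g D.

(** Differentiate the constant [g xi xi = 1] along [X] by metric compatibility. *)
Lemma acm_eta_nabla_xi X : eta (D X xi) = 0.
Proof.
apply: smooth_mulr2n_eq0; have [_ /(_ X xi xi)] := hD.
by rewrite acm_metric_xi acm_eta_xi vfield_one [g xi _]metricC acm_metric_xi.
Qed.

Lemma lie_tensor_xiE X :
  lie_tensor xi phi X
    = nabla_tensor D xi phi X - (D (phi X) xi - phi (D X xi)).
Proof.
have [tf _] := hD; rewrite /lie_tensor /nabla_tensor -!tf linearB /=.
by rewrite !opprB addrACA [RHS]addrACA [- D (phi X) xi - _]addrC.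
Qed.

Variables alpha beta : smooth M.
Hypothesis hS : forall X Y, nabla_tensor D X phi Y =
  alpha *: (g X Y *: xi - eta Y *: X) +
  beta *: (g (phi X) Y *: xi - eta Y *: phi X).

(** In direction [xi], the [alpha] bracket is [eta X *: xi - eta X *: xi], and the [beta] bracket
    vanishes with [phi xi]. *)
Lemma trans_sasakian_nabla_xi_phi X : nabla_tensor D xi phi X = 0.
Proof.
rewrite hS acm_phi_xi [g 0 _]metricC acm_metric0r [g xi X]metricC.
by rewrite acm_metric_xi subrr !scaler0 scale0r subrr scaler0 addr0.
Qed.

Lemma trans_sasakian_phi_nabla_xi X :
  phi (D X xi) = - (alpha *: phi (phi X)) + beta *: phi X.
Proof.
have := hS X xi; rewrite /nabla_tensor acm_phi_xi nabla_zero sub0r.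
rewrite !acm_metric_xi acm_eta_phi acm_eta_xi scale0r sub0r !scale1r.
(* The [alpha] bracket [eta X *: xi - X] is [phi^2 X]. *)
rewrite [_ *: xi - X]addrC -acm_phi2 scalerN => /(congr1 -%R).
by rewrite opprK opprD opprK.
Qed.

Lemma trans_sasakian_nabla_xi X :
  D X xi = - (alpha *: phi X) - beta *: phi (phi X).
Proof.
(* On [D X xi], which [eta] kills, [phi^2] is [-1], so [phi] can be inverted. *)
have := acm_phi2 S (D X xi); rewrite acm_eta_nabla_xi scale0r addr0.
rewrite trans_sasakian_phi_nabla_xi linearD linearN ![phi (_ *: _)]linearZ /= acm_phi3.
by rewrite scalerN opprK => /(congr1 -%R); rewrite opprK opprD.
Qed.

Lemma trans_sasakian_lie_tensor_xi X : lie_tensor xi phi X = 0.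
Proof.
rewrite lie_tensor_xiE trans_sasakian_nabla_xi_phi.
(* Both terms equal [- alpha phi^2 X + beta phi X]. *)
rewrite trans_sasakian_phi_nabla_xi trans_sasakian_nabla_xi acm_phi3.
by rewrite scalerN opprK subrr subr0.
Qed.

End LeviCivita.
End AlmostContactMetric.

Theorem proposition5p2 (R : realType) (n : nat) (M : manifold R n.*2.+1)
    (S : almost_contact_metric M) (D : connection M)
    (hD : levi_civita (acm_metric S) D)
    (hS : trans_sasakian S D)
    (h : {linear vfield M -> vfield M})
    (hE : forall X : vfield M, h X *+ 2 = lie_tensor (acm_xi S) (acm_phi S) X) :
  forall X : vfield M, h X = 0.
Proof.
case: hS => alpha [beta nablaE] X.
apply: vfield_mulr2n_eq0.
by rewrite hE (trans_sasakian_lie_tensor_xi _ _ _ _ D hD alpha beta nablaE).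
Qed.
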